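(* Let $n\ge 1$ and let $k_1,\dots,k_n$ be nonnegative integers, and put $k=\sum_{i=1}^n i k_i$ (the number of cyclic points). The number of parking functions $\pi$ of length $n$ such that $G_\pi$ has exactly $k_i$ cycles of length $i$ for every $i\in[n]$ is $$\begin{cases}\dfrac{1}{\prod_{i=1}^n i^{k_i}k_i!}\, n! & \text{if } k=n,\\[2mm] \dfrac{1}{\prod_{i=1}^n i^{k_i}k_i!}\dbinom{n+1}{k}k!\cdot k\,(n+1)^{n-k-2} & \text{if } 1\le k<n.\end{cases}$$
   Context: $[n]=\{1,\dots,n\}$. Parking functions: there are $n$ parking spaces $1,\dots,n$ in order on a one-way street and $n$ cars $C_1,\dots,C_n$ arriving in this order; car $C_i$ has preferred space $\pi_i\in[n]$, drives to space $\pi_i$ and parks in the first available space among $\pi_i,\pi_i+1,\dots,n$ (leaving unparked if there is none). The sequence $\pi=(\pi_1,\dots,\pi_n)$ is a parking function of length $n$ if all cars are able to park. The digraph $G_\pi$ has vertex set $[n]$ and edges $i\to\pi_i$. Cycles are directed cycles of $G_\pi$, with fixed points (loops) being cycles of length $1$; cyclic points are the vertices lying on cycles. *)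

(* Defs.v *)
From mathcomp Require Import all_boot all_order all_algebra.

Set Implicit Arguments.
Unset Strict Implicit.
Unset Printing Implicit Defensive.

(* The spaces, the cars and the vertices 1, ..., n are
   represented by the ordinals 0, ..., n-1 of 'I_n. *)

(* The enumeration of 'I_n is increasing, so the head is the least such s. *)
Definition first_free n (occ : {set 'I_n}) (p : 'I_n) : option 'I_n :=
  ohead [seq s : 'I_n <- enum 'I_n | (p <= s) && (s \notin occ)].

(* prefs lists the preferences of the cars still to arrive, occ is the set of
   spaces already taken. *)
Fixpoint all_park n (occ : {set 'I_n}) (prefs : seq 'I_n) : bool :=
  if prefs is p :: prefs' then
    if first_free occ p is Some s then all_park (s |: occ) prefs' else false
  else true.

Definition parking_function n (pi : {ffun 'I_n -> 'I_n}) : bool :=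
  all_park set0 [seq pi i | i <- enum 'I_n].

(* G_pi has out-degree 1, so a directed cycle is determined by its vertex set;
   counting vertex sets identifies the rotations of a closed walk
   c_1 -> c_2 -> ... -> c_l -> c_1 with distinct vertices. Only meaningful for
   l > 0, since the empty sequence is an fcycle. *)
Definition cycles_of_length n (pi : {ffun 'I_n -> 'I_n}) (l : nat) :
    {set {set 'I_n}} :=
  [set [set x in c] | c : l.-tuple 'I_n & fcycle pi c && uniq c].

(* Only the values k 1, ..., k n matter. *)
Definition has_cycle_counts n (k : nat -> nat) (pi : {ffun 'I_n -> 'I_n}) :
    bool :=
  all (fun i => #|cycles_of_length pi i| == k i) (iota 1 n).

Definition parking_functions_with_cycle_counts n (k : nat -> nat) :
    {set {ffun 'I_n -> 'I_n}} :=
  [set pi | parking_function pi && has_cycle_counts k pi].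

(* Main.v *)
(* Let P be the set of parking functions; it is closed under permuting the cars.

   If a family X of functions is closed under precomposition with the
   permutations supported in C, then moving a fixed sequence a of m distinct
   points of C onto c shows, for each c, that as many f in X satisfy f c = rot c
   as satisfy f a = rot c; hence the f in X mapping a injectively into C are
   equinumerous with the pairs (f, c) such that f c = rot c.
   With rot = id, C = everything and X = P, and then with C fixed and X the set of
   f in P whose cyclic points form C, this yields
     #{f in P | f is injective on a} = #{f in P | f has at least m cyclic points}.
   With rot the cyclic shift, c runs over the cycles of length m, and removing one
   cycle at a time shows that all cycle types on the cyclic points are distributed
   as in a uniform random permutation.

   Finally the number D_m of f in P injective on a is given by Pollak's circle
   argument, D_m (n+1) = (n+1)_m (n+1)^(n-m), and K cyclic points occur
   D_K - D_(K+1) times. *)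

Require Import Defs.
From mathcomp Require Import fingroup perm zify ring.
From mathcomp Require Import all_boot all_order all_algebra.
Set Implicit Arguments.
Unset Strict Implicit.
Unset Printing Implicit Defensive.

(** * Parking as a bound on the load of every final segment *)

Lemma card_ord_geq n j : #|[set s : 'I_n | j <= s]| = n - j.
Proof.
have := @big_geq_mkord _ 0 addn j n xpredT (fun=> 1).
by rewrite sum_nat_const_nat muln1 -sum1dep_card => ->.
Qed.

Lemma card_ord_geq_split n (occ : {set 'I_n}) (i j : nat) :
    i <= j -> j <= n -> (forall t : 'I_n, i <= t < j -> t \in occ) ->
  #|[set s in occ | i <= s]| = j - i + #|[set s in occ | j <= s]|.
Proof.
move=> le_ij le_jn occ_ij; rewrite -(cardsID [set s : 'I_n | s < j]).
congr (_ + _); last first.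
  by apply: eq_card => s; rewrite !inE -leqNgt; case: (s \in occ) => //=; lia.
have -> : j - i = (n - i) - (n - j) by lia.
rewrite -(card_ord_geq n i) -(card_ord_geq n j).
rewrite -(cardsID [set s : 'I_n | j <= s] [set s : 'I_n | i <= s]).
have -> : [set s : 'I_n | i <= s] :&: [set s : 'I_n | j <= s] = [set s : 'I_n | j <= s].
  by apply/setP=> s; rewrite !inE; lia.
rewrite addnC addnK; apply: eq_card => s; rewrite !inE -ltnNge.
by case: (boolP (s \in occ)) => /= [_ | /(contraNN (occ_ij s))]; lia.
Qed.

Variant first_free_spec n (occ : {set 'I_n}) (p : 'I_n) : option 'I_n -> Prop :=
| FirstFree (s : 'I_n) of p <= s & s \notin occ
    & (forall t : 'I_n, p <= t < s -> t \in occ) : first_free_spec occ p (Some s)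
| NoneFree of (forall t : 'I_n, p <= t -> t \in occ) : first_free_spec occ p None.

Lemma first_freeP n (occ : {set 'I_n}) p : first_free_spec occ p (first_free occ p).
Proof.
rewrite /first_free; set P := (fun s : 'I_n => _).
have : sorted (relpre val ltn) [seq s <- enum 'I_n | P s].
  apply: sorted_filter; first by move=> ? ? ?; apply: ltn_trans.
  by rewrite -sorted_map val_enum_ord iota_ltn_sorted.
have mem_free t : (t \in [seq s <- enum 'I_n | P s]) = P t.
  by rewrite mem_filter mem_enum andbT.
case: [seq s <- enum 'I_n | P s] mem_free => [|s l] mem_free /= path_l.
  by constructor=> t le_pt; have := mem_free t; rewrite /P le_pt /= => /esym/negbFE.
have /andP[le_ps s_free] : P s by rewrite -mem_free mem_head.
constructor=> // t /andP[le_pt lt_ts]; apply: contraT => t_free.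
have : t \in s :: l by rewrite mem_free /P le_pt.
have trans_lt : transitive (relpre val ltn : rel 'I_n).
  by move=> ? ? ?; apply: ltn_trans.
rewrite inE => /predU1P[eq_ts|]; first by rewrite eq_ts ltnn in lt_ts.
by move/(allP (order_path_min trans_lt path_l)) => /=; lia.
Qed.

(** Induction on the arriving cars. Parking [p] at [s] changes the load of the final segment at [j]
    only when [p < j <= s], where it grows by one. The spaces from [p] to [j - 1] are then all
    taken, so the bound at [p] leaves room for the extra unit at [j]. *)
Lemma all_parkE n (occ : {set 'I_n}) prefs :
  all_park occ prefs =
  [forall j : 'I_n,
     #|[set s in occ | j <= s]| + count (fun p : 'I_n => j <= p) prefs <= n - j].
Proof.
elim: prefs occ => [|p prefs IHp] occ /=.
  apply/esym/forallP => j; rewrite addn0 -card_ord_geq.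
  by apply: subset_leq_card; apply/subsetP=> s; rewrite !inE => /andP[].
have [s le_ps s_free occ_ps|occ_p] := first_freeP occ p; last first.
  apply/esym/negbTE/forallPn; exists p; rewrite leqnn -ltnNge.
  suff -> : [set s in occ | p <= s] = [set s : 'I_n | p <= s] by rewrite card_ord_geq; lia.
  by apply/setP => s; rewrite !inE; case: (leqP p s) => [/occ_p->|]; rewrite ?andbF.
rewrite IHp.
have add_s (j : 'I_n) :
    #|[set t in s |: occ | j <= t]| = (j <= s) + #|[set t in occ | j <= t]|.
  case: (leqP j s) => [le_js|lt_sj].
    have -> : [set t in s |: occ | j <= t] = s |: [set t in occ | j <= t].
      by apply/setP=> t; rewrite !inE; case: eqP => //= ->; rewrite le_js.
    by rewrite cardsU1 !inE (negbTE s_free).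
  by apply: eq_card => t; rewrite !inE; case: eqP => //= ->; rewrite leqNgt lt_sj andbF.
apply/forallP/forallP=> le_load j; have := le_load j; rewrite add_s.
  by move: #|_| (count _ _) => A B; case: (leqP j p) => [le_jp|_];
    [rewrite (leq_trans le_jp le_ps)|]; lia.
move=> le_j; case: (ltnP p j) => [lt_pj|le_jp]; last first.
  by move: le_j; rewrite le_jp (leq_trans le_jp le_ps); move: #|_| (count _ _) => A B; lia.
case: (leqP j s) => [le_js|lt_sj]; last first.
  by move: le_j; rewrite [j <= p]leqNgt lt_pj; move: #|_| (count _ _) => A B; lia.
have := le_load p; rewrite leqnn.
rewrite (card_ord_geq_split (ltnW lt_pj) (ltnW (ltn_ord j))); last first.
  by move=> t /andP[le_pt lt_tj]; apply: occ_ps; rewrite le_pt (leq_trans lt_tj).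
have := @sub_count _ (fun q : 'I_n => j <= q) (fun q : 'I_n => p <= q) _ prefs.
move=> /(_ (fun q => leq_trans (ltnW lt_pj))).
have := ltn_ord j; lia.
Qed.

Lemma parking_functionE n (pi : {ffun 'I_n -> 'I_n}) :
  parking_function pi = [forall j : 'I_n, #|[set i | j <= pi i]| <= n - j].
Proof.
rewrite /parking_function all_parkE; apply: eq_forallb => j.
rewrite (_ : [set s in set0 | _] = set0) ?cards0 ?add0n; last first.
  by apply/setP=> s; rewrite !inE.
by rewrite count_map cardsE cardE -size_filter enumT.
Qed.

(** * Moving values around by permuting arguments *)

Definition precomp (T : finType) (f : {ffun T -> T}) (s : {perm T}) : {ffun T -> T} :=
  [ffun x => f (s x)].

Lemma parking_function_precomp n (pi : {ffun 'I_n -> 'I_n}) (s : 'S_n) :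
  parking_function (precomp pi s) = parking_function pi.
Proof.
rewrite !parking_functionE; apply: eq_forallb => j; congr (_ <= _).
rewrite -(card_preimset [set i | j <= pi i] (@perm_inj _ s)).
by apply: eq_card => i; rewrite !inE ffunE.
Qed.

(** Induction: take the permutation [s] for the tails, followed by the transposition of [s x] and
    [y]. Neither of these lies in [b], so the tails stay matched. *)
Lemma exists_perm_on_map (T : finType) (C : {set T}) (a b : seq T) :
    uniq a -> uniq b -> size a = size b -> all (mem C) a -> all (mem C) b ->
  exists2 s : {perm T}, perm_on C s & map s a = b.
Proof.
elim: a b => [|x a IHa] [|y b] //=; first by exists 1%g => //; apply: perm_on1.
move=> /andP[xa uniq_a] /andP[yb uniq_b] [eq_sz] /andP[xC aC] /andP[yC bC].
have [s sC def_b] := IHa b uniq_a uniq_b eq_sz aC bC.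
have sxb : s x \notin b by rewrite -def_b (mem_map perm_inj).
have sxC : s x \in C by rewrite (perm_closed x sC).
exists (s * tperm (s x) y)%g.
  apply: perm_onM => //; apply: subset_trans (tperm_on _ _) _.
  by apply/subsetP=> z /set2P[]->.
rewrite permM tpermL -def_b; congr (_ :: _); apply/eq_in_map => z za.
have szb : s z \in b by rewrite -def_b map_f.
by rewrite permM tpermD //; [apply: contraNneq sxb | apply: contraNneq yb] => ->.
Qed.

Definition precomp_closed (T : finType) (C : {set T}) (X : {set {ffun T -> T}}) :=
  forall (s : {perm T}) f, perm_on C s -> f \in X -> precomp f s \in X.

Lemma precomp_inj (T : finType) (s : {perm T}) :
  injective (fun f : {ffun T -> T} => precomp f s).
Proof.
move=> f g /ffunP eq_fg; apply/ffunP=> x.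
by have := eq_fg (s^-1%g x); rewrite !ffunE permKV.
Qed.

(** If [map s a = b], the injection sending [f] to [precomp f s] turns functions with values [v] on
    [b] into functions with values [v] on [a]. *)
Lemma leq_card_precomp_map (T : finType) (C : {set T}) (X : {set {ffun T -> T}})
    (a b v : seq T) :
    precomp_closed C X -> uniq a -> uniq b -> size a = size b ->
    all (mem C) a -> all (mem C) b ->
  #|[set f in X | map f b == v]| <= #|[set f in X | map f a == v]|.
Proof.
move=> clX ua ub eq_sz aC bC; have [s sC def_b] := exists_perm_on_map ua ub eq_sz aC bC.
rewrite -(card_imset _ (@precomp_inj T s)); apply: subset_leq_card.
apply/subsetP=> _ /imsetP[f /[!inE]/andP[fX /eqP <-] ->]; rewrite clX //= -def_b.
by rewrite -map_comp; apply/eqP/eq_map => x; rewrite ffunE.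
Qed.

Lemma card_precomp_map (T : finType) (C : {set T}) (X : {set {ffun T -> T}}) (a b v : seq T) :
    precomp_closed C X -> uniq a -> uniq b -> size a = size b ->
    all (mem C) a -> all (mem C) b ->
  #|[set f in X | map f a == v]| = #|[set f in X | map f b == v]|.
Proof.
by move=> clX *; apply/eqP; rewrite eqn_leq !(leq_card_precomp_map _ clX).
Qed.

Lemma card_map_tuple (T R : finType) (X : {set {ffun T -> R}}) m (a : m.-tuple T)
    (P : pred (seq R)) :
  #|[set f in X | P (map f a)]| = \sum_(c : m.-tuple R | P c) #|[set f in X | map f a == c]|.
Proof.
rewrite -sum1dep_card (partition_big (fun f : {ffun T -> R} => map_tuple f a) P) /=.
  apply: eq_bigr => c Pc; rewrite -sum1dep_card; apply: eq_bigl => f.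
  rewrite -val_eqE /= -!andbA; congr (_ && _).
  by case: eqP => [->|]; rewrite ?andbF ?andbT.
by move=> f /andP[].
Qed.

(** Transporting [c] to [a] turns each summand into the number of [f] with [map f a == rot r c].
    Rotation permutes the injective tuples in [C], so the sum runs over all the allowed images of
    [a]. *)
Lemma sum_card_map_rot (T : finType) (C : {set T}) (X : {set {ffun T -> T}}) m r
    (a : m.-tuple T) :
    precomp_closed C X -> uniq a -> all (mem C) a ->
  \sum_(c : m.-tuple T | uniq c && all (mem C) c) #|[set f in X | map f c == rot r c]| =
  #|[set f in X | uniq (map f a) && all (mem C) (map f a)]|.
Proof.
move=> clX ua aC.
rewrite (card_map_tuple X a (fun c => uniq c && all (mem C) c)).
rewrite [RHS](reindex_inj (h := fun c : m.-tuple T => [tuple of rot r c])) /=; last first.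
  by move=> c d /(congr1 val) /= /rot_inj /val_inj.
apply: eq_big => [c|c /andP[uc cC]].
  by rewrite rot_uniq; congr (_ && _); apply/esym/eq_all_r => x; rewrite mem_rot.
by apply: (card_precomp_map _ clX); rewrite ?size_tuple.
Qed.

(** * Pollak's circle argument *)

(* A function parks on the circle of n + 1 spaces without ever using the last one. *)
Definition circular_parking n (f : {ffun 'I_n -> 'I_n.+1}) : bool :=
  [forall j : 'I_n.+1, j <= #|[set i | f i < j]|].

Definition rotate n (f : {ffun 'I_n -> 'I_n.+1}) (c : 'I_n.+1) : {ffun 'I_n -> 'I_n.+1} :=
  [ffun i => (f i - c)%R].

Lemma val_ord_sub n (x c : 'I_n.+1) :
  val (x - c)%R = if c <= x then x - c else x + n.+1 - c.
Proof.
rewrite /= modnDmr; have := ltn_ord x; have := ltn_ord c.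
case: (leqP c x) => le_cx lt_c lt_x.
  by rewrite (_ : x + (n.+1 - c) = n.+1 + (x - c)) ?modnDl ?modn_small; lia.
by rewrite modn_small; lia.
Qed.

Lemma card_set_sum (T : finType) (P : pred T) : #|[set x | P x]| = \sum_x P x.
Proof. by rewrite -sum1dep_card big_mkcond; apply: eq_bigr => x _; case: (P x). Qed.

(** Rotated preferences below [j] are original preferences in the arc of [j] spaces starting at [c];
    in the second branch this arc contains the last space [n]. *)
Lemma card_rotate_lt n (f : {ffun 'I_n -> 'I_n.+1}) (c j : 'I_n.+1) :
  #|[set i | rotate f c i < j]| + #|[set i | f i < c]| =
  if c + j <= n then #|[set i | f i < c + j]| else n + #|[set i | f i < c + j - n.+1]|.
Proof.
rewrite !card_set_sum.
have -> s : n + s = \sum_(i < n) 1 + s by rewrite sum1_card card_ord.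
rewrite -!big_split /=.
case: (leqP (c + j) n) => le_n; apply: eq_bigr => i _; rewrite ffunE val_ord_sub;
  have := ltn_ord (f i); have := ltn_ord c; have := ltn_ord j; case: (leqP c (f i)); lia.
Qed.

(** Write A_t for the number of [i] with [f i < t]. The condition says that A_t - t is minimal at
    [c], and strictly larger at every [t < c]. Here [t] is the end of an arc starting at [c];
    strictness comes from wrapping round, which passes [n.+1] spaces but only [n] cars. *)
Lemma circular_parking_rotate n (f : {ffun 'I_n -> 'I_n.+1}) (c : 'I_n.+1) :
  circular_parking (rotate f c) =
  [forall t : 'I_n.+1,
     #|[set i | f i < c]| + t + (t < c) <= #|[set i | f i < t]| + c].
Proof.
apply/forallP/forallP => [park t | min_c j].
  have := ltn_ord t; have := ltn_ord c => lt_c lt_t.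
  case: (leqP c t) => [le_ct|lt_tc].
    have lt_j : t - c < n.+1 by lia.
    have := park (Ordinal lt_j); have := card_rotate_lt f c (Ordinal lt_j).
    by rewrite /= subnKC // -ltnS lt_t; lia.
  have lt_j : n.+1 + t - c < n.+1 by lia.
  have := park (Ordinal lt_j); have := card_rotate_lt f c (Ordinal lt_j).
  rewrite /= subnKC; last by lia.
  by rewrite leqNgt ltnS leq_addr /= addKn; lia.
have := card_rotate_lt f c j; have := ltn_ord j; have := ltn_ord c.
case: (leqP (c + j) n) => [le_n lt_c lt_j|lt_n lt_c lt_j].
  by have := min_c (Ordinal (le_n : c + j < n.+1)) => /=; lia.
have lt_t : c + j - n.+1 < n.+1 by lia.
by have := min_c (Ordinal lt_t) => /=; lia.
Qed.

(* The cycle lemma: c is the first minimiser of #{i | f i < t} - t. *)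
Lemma circular_parking_rotate_unique n (f : {ffun 'I_n -> 'I_n.+1}) :
  exists c, forall d, circular_parking (rotate f d) = (d == c).
Proof.
(* A lexicographic weight: first A_t - t, shifted by [n] to stay in the naturals, then [t] itself to
   break ties. The weight modulo [n.+1] gives [t] back, whence uniqueness. *)
pose w (t : 'I_n.+1) := (#|[set i | f i < t]| + (n - t)) * n.+1 + t.
have [c _ min_c] := arg_minnP w (erefl true : xpredT (ord0 : 'I_n.+1)).
have park_w d : circular_parking (rotate f d) <-> (forall t, w d <= w t).
  rewrite circular_parking_rotate; split=> [/forallP min_d t | min_d]; last apply/forallP=> t;
    have := min_d t; have := ltn_ord t; have := ltn_ord d; rewrite /w;
    move: #|_| #|_| => A B; case: (ltnP t d); nia.
exists c => d; apply/idP/eqP => [/park_w min_d | ->]; last by apply/park_w => t; apply: min_c.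
have := congr1 (modn^~ n.+1) (anti_leq (introT andP (conj (min_d c) (min_c d isT)))).
by rewrite /w /= !modnMDl !modn_small // => /val_inj.
Qed.

(** Double counting of the pairs (f, c) such that [rotate f c] parks and [Q f] holds: each [f] has
    exactly one such [c], and each [c] contributes equally because rotation by [c] is a bijection
    preserving [Q]. *)
Lemma card_circular_parking n (Q : pred {ffun 'I_n -> 'I_n.+1}) :
    (forall f c, Q (rotate f c) = Q f) ->
  #|[set f | circular_parking f && Q f]| * n.+1 = #|[set f | Q f]|.
Proof.
move=> Qrot.
have rotate_inj c : injective (fun f : {ffun 'I_n -> 'I_n.+1} => rotate f c).
  move=> f g /ffunP eq_fg; apply/ffunP=> i; have := eq_fg i.
  by rewrite !ffunE => /GRing.addIr.
transitivity (\sum_(c < n.+1) #|[set f | circular_parking (rotate f c) && Q f]|).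
  rewrite (eq_bigr (fun=> #|[set f | circular_parking f && Q f]|)) => [|c _].
    by rewrite sum_nat_const card_ord mulnC.
  rewrite -[RHS](card_preimset _ (@rotate_inj c)).
  by apply: eq_card => f; rewrite !inE Qrot.
under eq_bigr do rewrite card_set_sum.
rewrite exchange_big /= card_set_sum; apply: eq_bigr => f _.
have [c def_c] := circular_parking_rotate_unique f.
rewrite (bigD1 c) //= def_c eqxx big1 ?addn0 // => d /negbTE neq_dc.
by rewrite def_c neq_dc.
Qed.

Lemma card_ffun_map (T R : finType) (a : seq T) (v : seq R) :
    uniq a -> size a = size v ->
  #|[set f : {ffun T -> R} | map f a == v]| = #|R| ^ (#|T| - size a).
Proof.
(* An empty [v] offers no default value for [nth], so it is settled apart. *)
case: v => [_ /eqP/nilP-> |r0 v' ua]; first by rewrite cardsT card_ffun subn0.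
move: {v'}(r0 :: v') => v eq_sz.
(* One value is allowed at each entry of [a] and every value elsewhere, so the functions form a
   product of finite sets. *)
pose F x : pred R := [pred y | (x \in a) ==> (y == nth r0 v (index x a))].
have -> : #|[set f : {ffun T -> R} | map f a == v]| = #|family F|.
  apply: eq_card => f; rewrite inE; apply/eqP/familyP => [def_v x | famF].
    rewrite inE; apply/implyP=> xa.
    by rewrite -def_v (nth_map x) ?index_mem ?nth_index.
  apply: (@eq_from_nth _ r0); rewrite size_map // => i lt_i.
  have x0 : T by case: (a) lt_i.
  have := famF (nth x0 a i); rewrite inE mem_nth //= index_uniq // => /eqP <-.
  by rewrite (nth_map x0).
rewrite card_family foldrE big_map big_enum (bigID (mem a)) /=.
rewrite big1 ?mul1n => [|x xa]; last first.
  by rewrite -(card1 (nth r0 v (index x a))); apply: eq_card => y; rewrite !inE [x \in a]xa.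
rewrite (eq_bigr (fun=> #|R|)) => [|x xa]; last first.
  by apply: eq_card => y; rewrite !inE (negbTE xa).
rewrite -(cardC (mem a)) (card_uniqP ua) addKn -prod_nat_const.
by apply: eq_bigl => x; rewrite !inE.
Qed.

Lemma card_ffun_uniq_map (T R : finType) (a : seq T) : uniq a ->
  #|[set f : {ffun T -> R} | uniq (map f a)]| = #|R| ^_ size a * #|R| ^ (#|T| - size a).
Proof.
move=> ua; transitivity #|[set f in [set: {ffun T -> R}] | uniq (map f a)]|.
  by apply: eq_card => f; rewrite !inE.
rewrite (card_map_tuple _ (in_tuple a)) /= -card_uniq_tuples -sum1dep_card big_distrl /=.
apply: eq_big => [c|c uc]; first by rewrite all_predT.
rewrite mul1n -(card_ffun_map ua (esym (size_tuple c))).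
by apply: eq_card => f; rewrite !inE.
Qed.

(** Complementary counts exchange the two criteria. The additional condition at [j = n] is
    automatic, since all preferences are below [n]. *)
Lemma circular_parking_widen n (pi : {ffun 'I_n -> 'I_n}) :
  circular_parking [ffun i => widen_ord (leqnSn n) (pi i)] = parking_function pi.
Proof.
have eqC j : #|[set i | j <= pi i]| + #|[set i | pi i < j]| = n.
  rewrite -[RHS](card_ord n) -(cardsC [set i | j <= pi i]); congr (_ + _).
  by apply: eq_card => i; rewrite !inE ltnNge.
have widenE (j : nat) :
    [set i | [ffun i => widen_ord (leqnSn n) (pi i)] i < j] = [set i | pi i < j].
  by apply/setP=> i; rewrite !inE ffunE.
rewrite parking_functionE; apply/forallP/forallP => [park j | park j].
  have := park (widen_ord (leqnSn n) j); rewrite widenE.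
  by have := eqC j; have := ltn_ord j => /=; lia.
rewrite widenE; have := ltn_ord j; rewrite ltnS leq_eqVlt.
case/predU1P => [-> | lt_jn].
  have -> : [set i | pi i < n] = setT by apply/setP=> i; rewrite !inE ltn_ord.
  by rewrite cardsT card_ord.
by have := park (Ordinal lt_jn); have := eqC j => /=; lia.
Qed.

Lemma card_parking_uniq_map n (a : seq 'I_n) : uniq a ->
  #|[set pi : {ffun 'I_n -> 'I_n} | parking_function pi && uniq (map pi a)]| * n.+1 =
  n.+1 ^_ size a * n.+1 ^ (n - size a).
Proof.
move=> ua; have := @card_ffun_uniq_map 'I_n 'I_n.+1 a ua; rewrite !card_ord => <-.
rewrite -card_circular_parking => [|f c]; last first.
  rewrite -[RHS](map_inj_uniq (@GRing.addIr _ (- c)%R)) -map_comp.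
  by congr uniq; apply: eq_map => i; rewrite ffunE.
congr (_ * _).
pose wid (pi : {ffun 'I_n -> 'I_n}) := [ffun i => widen_ord (leqnSn n) (pi i)].
have inj_ord : injective (widen_ord (leqnSn n)).
  by move=> x y /(congr1 val) /= /val_inj.
have inj_wid : injective wid.
  by move=> f g /ffunP eq_fg; apply/ffunP=> i; have := eq_fg i; rewrite !ffunE => /inj_ord.
have uniq_wid pi : uniq (map (wid pi) a) = uniq (map pi a).
  rewrite -[RHS](map_inj_uniq inj_ord) -map_comp; congr uniq.
  by apply: eq_map => i; rewrite ffunE.
rewrite -(card_imset _ inj_wid); apply: eq_card => f.
rewrite inE; apply/imsetP/andP => [[pi /[!inE]/andP[park upi] ->]|[park uf]].
  by rewrite circular_parking_widen uniq_wid.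
(* The condition at [j = n] forces all [n] preferences to avoid the last space, so [f] comes from a
   map into ['I_n]. *)
have lt_f i : f i < n.
  have := forallP park ord_max; rewrite /= -{1}(card_ord n) -cardsT => le_T.
  suff : i \in [set i | f i < n] by rewrite inE.
  have /eqP-> : [set i | f i < n] == setT by rewrite eqEcard subsetT le_T.
  by rewrite inE.
exists [ffun i => Ordinal (lt_f i)].
  have def_f : f = wid [ffun i => Ordinal (lt_f i)].
    by apply/ffunP=> i; rewrite !ffunE; apply: val_inj.
  by rewrite inE -uniq_wid -circular_parking_widen -[X in circular_parking X]/(wid _) -def_f park.
by apply/ffunP=> i; rewrite !ffunE; apply: val_inj.
Qed.

(** * Cyclic points and injectivity on a given sequence *)

(** By finiteness [f] permutes every [S] with [f @: S = S], so such sets are exactly the unions of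
    cycles, and their union is the largest of them. *)
Definition cyclic_points (T : finType) (f : {ffun T -> T}) : {set T} :=
  \bigcup_(S : {set T} | f @: S == S) S.

Lemma imset_cyclic_points (T : finType) (f : {ffun T -> T}) :
  f @: cyclic_points f = cyclic_points f.
Proof.
apply/setP=> y; apply/imsetP/bigcupP => [[x /bigcupP[S /eqP fS xS] ->]|[S /eqP fS yS]].
  by exists S; [rewrite fS | rewrite -fS imset_f].
move: yS; rewrite -{1}fS => /imsetP[x xS ->]; exists x => //.
by apply/bigcupP; exists S; rewrite ?fS.
Qed.

Lemma sub_cyclic_points (T : finType) (f : {ffun T -> T}) (S : {set T}) :
  f @: S = S -> S \subset cyclic_points f.
Proof. by move=> fS; apply: (bigcup_sup S); rewrite ?fS. Qed.

Lemma imset_precomp (T : finType) (f : {ffun T -> T}) (s : {perm T}) (D : {set T}) :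
  perm_on D s -> precomp f s @: D = f @: D.
Proof.
move=> sD; rewrite -{2}(im_perm_on sD) -imset_comp.
by apply: eq_imset => x; rewrite ffunE.
Qed.

(** The old cyclic set is still mapped onto itself, hence is contained in the new one. So [s] is
    also supported in the new set, which [f] therefore maps onto itself: this gives the other
    inclusion. *)
Lemma cyclic_points_precomp (T : finType) (f : {ffun T -> T}) (s : {perm T}) :
  perm_on (cyclic_points f) s -> cyclic_points (precomp f s) = cyclic_points f.
Proof.
move=> sC; have sub_C : cyclic_points f \subset cyclic_points (precomp f s).
  by apply: sub_cyclic_points; rewrite imset_precomp // imset_cyclic_points.
apply/eqP; rewrite eqEsubset sub_C andbT; apply: sub_cyclic_points.
rewrite -[RHS]imset_cyclic_points imset_precomp //.
exact: subset_trans sC sub_C.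
Qed.

Lemma imset_self_inj (T : finType) (f : T -> T) (C : {set T}) :
  f @: C = C -> {in C &, injective f}.
Proof. by move=> fC; apply/imset_injP; rewrite fC. Qed.

Lemma imset_self_uniq_map (T : finType) (f : T -> T) (C : {set T}) (s : seq T) :
  f @: C = C -> uniq s -> all (mem C) s -> uniq (map f s) && all (mem C) (map f s).
Proof.
move=> fC us /allP sC; rewrite map_inj_in_uniq ?us => [|x y /sC xC /sC yC]; last first.
  exact: (imset_self_inj fC).
by apply/allP=> _ /mapP[x /sC xC ->] /=; rewrite -fC imset_f.
Qed.

Lemma exists_uniq_tuple (T : finType) (C : {set T}) m :
  m <= #|C| -> exists2 a : m.-tuple T, uniq a & all (mem C) a.
Proof.
move=> le_m; have sz : size (take m (enum C)) == m by rewrite size_takel // -cardE.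
exists (Tuple sz) => /=; first exact: (take_uniq _ (enum_uniq _)).
by apply/allP=> x /mem_take; rewrite mem_enum.
Qed.

Lemma card_cyclic_points_eq (T : finType) (X : {set {ffun T -> T}}) (P : pred {ffun T -> T}) :
  #|[set f in X | P f]| =
  \sum_(C : {set T}) #|[set f in [set g in X | cyclic_points g == C] | P f]|.
Proof.
rewrite -sum1dep_card (partition_big (@cyclic_points T) predT) //=.
apply: eq_bigr => C _; rewrite -sum1dep_card; apply: eq_bigl => f.
by rewrite !inE -!andbA [P f && _]andbC.
Qed.

Lemma precomp_closed_cyclic_points (T : finType) (X : {set {ffun T -> T}}) (C : {set T}) :
  precomp_closed setT X -> precomp_closed C [set f in X | cyclic_points f == C].
Proof.
move=> clX s f sC /[!inE]/andP[fX /eqP def_C].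
rewrite clX ?cyclic_points_precomp ?def_C ?eqxx //.
exact: subset_trans sC (subsetT _).
Qed.

(** Fixed points are cyclic, so only tuples in [C] contribute. Moving them to one tuple [a] in [C]
    leaves the condition that [f] maps [a] injectively into [C], which always holds because [f]
    permutes [C]. *)
Lemma sum_card_map_fixed (T : finType) (X : {set {ffun T -> T}}) (C : {set T}) m :
    precomp_closed setT X ->
  \sum_(c : m.-tuple T | uniq c)
     #|[set f in [set g in X | cyclic_points g == C] | map f c == c]| =
  #|[set f in [set g in X | cyclic_points g == C] | m <= #|C|]|.
Proof.
move=> clX; set XC := [set g in X | _].
have fixC (f : {ffun T -> T}) (c : seq T) : f \in XC -> map f c = c -> all (mem C) c.
  rewrite inE => /andP[_ /eqP <-] fix_c; apply/allP => x xc.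
  have fx : f x = x.
    have /eq_in_map fix_in : map f c = map id c by rewrite map_id.
    exact: fix_in.
  by apply: (subsetP (@sub_cyclic_points _ f [set x] _)); rewrite ?set11 ?imset_set1 ?fx.
rewrite (bigID (fun c : m.-tuple T => all (mem C) c)) /= addnC big1; last first.
  move=> c /andP[_ cC].
  apply/eqP; rewrite cards_eq0 -subset0; apply/subsetP=> f /[!inE]/andP[fX /eqP fix_c].
  by rewrite (fixC f) ?inE in cC.
rewrite add0n; case: (leqP m #|C|) => [le_m|lt_C]; last first.
  rewrite big1 => [|c /andP[uc /allP cC]].
    by apply/esym/eqP; rewrite cards_eq0 -subset0; apply/subsetP=> f; rewrite !inE andbF.
  suff : m <= #|C| by rewrite leqNgt lt_C.
  rewrite -(size_tuple c) -(card_uniqP uc); apply: subset_leq_card.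
  by apply/subsetP=> x /cC.
have [a ua aC] := exists_uniq_tuple le_m.
under eq_bigr => c _ do rewrite -{2}(rot0 c).
rewrite (sum_card_map_rot 0 (@precomp_closed_cyclic_points T X C clX) ua aC).
apply: eq_card => f; rewrite !inE andbT; apply/andb_idr => /andP[_ /eqP def_C].
by apply: imset_self_uniq_map; rewrite // -def_C imset_cyclic_points.
Qed.

Lemma card_uniq_map_cyclic_points (T : finType) (X : {set {ffun T -> T}}) (a : seq T) :
    precomp_closed setT X -> uniq a ->
  #|[set f in X | uniq (map f a)]| = #|[set f in X | size a <= #|cyclic_points f|]|.
Proof.
move=> clX ua; have allT (s : seq T) : all (mem [set: T]) s by apply/allP=> x; rewrite inE.
have := sum_card_map_rot 0 (a := in_tuple a) clX ua (allT a) => /=.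
under [in X in _ = X -> _]eq_finset => f do rewrite allT andbT.
move=> <-.
under eq_bigl => c do rewrite allT andbT.
(* Injectivity on [a] has become a sum over pointwise fixed tuples; this sum is now split by cyclic
   set and evaluated again. *)
under eq_bigr => c _ do rewrite rot0 card_cyclic_points_eq.
rewrite exchange_big [RHS]card_cyclic_points_eq; apply: eq_bigr => C _ /=.
rewrite sum_card_map_fixed //; apply: eq_card => f; rewrite !inE.
by case: eqP => [->|] //; rewrite andbF.
Qed.

(** * Cycle types on a fixed cyclic set *)

Lemma fcycle_map_rot (T : eqType) (f : T -> T) (c : seq T) :
  fcycle f c = (map f c == rot 1 c).
Proof.
case: c => //= x p; rewrite rot1_cons.
have fpathE y : path (frel f) x (rcons p y) = (map f (x :: p) == rcons p y).
  by elim: p x => [|z p IHp] x /=; [rewrite eqseq_cons | rewrite eqseq_cons IHp].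
exact: fpathE.
Qed.

(** A tuple running once round a cycle is the orbit of its first entry, so [thead] is a bijection
    from these tuples to the points of order [i]. *)
Lemma card_fcycles (T : finType) (f : T -> T) (C : {set T}) i :
    f @: C = C -> 0 < i ->
  #|[set c : i.-tuple T | uniq c && all (mem C) c && (map f c == rot 1 c)]| =
  #|[set x in C | order f x == i]|.
Proof.
case: i => // i fC _.
set A := [set c : i.+1.-tuple T | uniq c && all (mem C) c && (map f c == rot 1 c)].
have orbit_thead (c : i.+1.-tuple T) : c \in A -> orbit f (thead c) = c.
  rewrite inE -fcycle_map_rot => /andP[/andP[uc _] fc].
  rewrite (orbitE fc uc) ?mem_tnth // (tuple_eta c) /= theadE eqxx rot0 //.
have thead_inj : {in A &, injective (@thead i T)}.
  by move=> c d cA dA eq_cd; apply: val_inj; rewrite /= -orbit_thead // eq_cd orbit_thead.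
rewrite -(card_in_imset thead_inj); apply: eq_card => x.
apply/imsetP/idP => [[c cA ->]|].
  have := orbit_thead c cA; move: cA; rewrite !inE => /andP[/andP[_ /allP cC] _] def_c.
  have cC0 : thead c \in C := cC _ (mem_tnth _ _).
  by rewrite cC0 -size_orbit def_c size_tuple eqxx.
rewrite inE => /andP[xC /eqP ord_x].
have homC : {homo f : y / y \in C} by move=> y yC; rewrite -fC imset_f.
have fcx := cycle_orbit_in homC (imset_self_inj fC) xC.
have sz_x : size (orbit f x) == i.+1 by rewrite size_orbit ord_x.
exists (Tuple sz_x); last by rewrite /thead (tnth_nth x) /= /orbit -orderSpred.
rewrite inE -fcycle_map_rot fcx orbit_uniq andbT /=.
apply/allP => y; rewrite -fconnect_orbit => /iter_findex <- /=.
by elim: (findex f x y) => //= m; apply: homC.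
Qed.

Lemma imset_self_setD (T : finType) (f : T -> T) (C D : {set T}) :
  f @: C = C -> f @: D = D -> D \subset C -> f @: (C :\: D) = C :\: D.
Proof.
move=> fC fD sDC; have f_inj := imset_self_inj fC.
apply/eqP; rewrite eqEcard card_in_imset ?leqnn ?andbT; last first.
  by move=> x y /setDP[xC _] /setDP[yC _]; apply: f_inj.
apply/subsetP => _ /imsetP[x /setDP[xC xnD] ->]; have fxC : f x \in C by rewrite -fC imset_f.
rewrite inE fxC andbT.
apply: contra xnD; rewrite -{1}fD => /imsetP[y yD /f_inj-> //].
exact: (subsetP sDC).
Qed.

Lemma imset_fcycle (T : finType) (f : T -> T) (c : seq T) :
  fcycle f c -> f @: [set x in c] = [set x in c].
Proof.
rewrite fcycle_map_rot => /eqP fc; apply/setP=> y; rewrite inE -(mem_rot 1) -fc.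
apply/imsetP/mapP => [[x /[!inE]xc ->]|[x xc ->]]; by exists x; rewrite ?inE.
Qed.

(* Counting points rather than cycles: i * k i points lie on cycles of length i. *)
Definition cycle_type_on (T : finType) N (C : {set T}) (k : nat -> nat) (f : T -> T) : bool :=
  all (fun i => #|[set x in C | order f x == i]| == i * k i) (index_iota 1 N.+1).

(** All entries of [c] have order [size c], so removing them lowers the count for that length by
    [size c] and affects no other length. *)
Lemma cycle_type_on_setD (T : finType) (f : T -> T) N (C : {set T}) (k k' : nat -> nat)
    (c : seq T) :
    fcycle f c -> uniq c -> all (mem C) c ->
    k (size c) = (k' (size c)).+1 -> (forall i, i != size c -> k i = k' i) ->
  cycle_type_on N C k f = cycle_type_on N (C :\: [set x in c]) k' f.
Proof.
move=> fc uc /allP cC k_c k_nc; apply: eq_in_all => i _.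
rewrite -(cardsID [set x in c] [set x in C | _]).
have -> : [set x in C | order f x == i] :\: [set x in c] =
          [set x in C :\: [set x in c] | order f x == i].
  by apply/setP=> x; rewrite !inE andbA.
have -> : #|[set x in C | order f x == i] :&: [set x in c]| = (i == size c) * i.
  case: eqP => [->|ne_i].
    rewrite mul1n -{2}(card_uniqP uc); apply: eq_card => x; rewrite !inE.
    by apply/andb_idl => xc; rewrite [x \in C]cC // (order_cycle fc) /=.
  apply/eqP; rewrite cards_eq0 -subset0; apply/subsetP => x; rewrite !inE.
  move=> /andP[/andP[_ /eqP def_i] xc].
  by case: ne_i; rewrite -def_i (order_cycle fc).
case: (eqVneq i (size c)) => [->|ne_i]; last by rewrite k_nc.
by rewrite k_c mul1n mulnS eqn_add2l.
Qed.

(** Induction on the size of [C], removing a cycle of some length [i] that occurs in the type. The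
    product is the order of the centralizer of a permutation of type [k]; it loses the factor
    [i * k i], the number of ways to mark an [i]-cycle together with a starting point. *)
Lemma card_cycle_type_on (T : finType) N (C : {set T}) (k : nat -> nat)
    (X : {set {ffun T -> T}}) :
    precomp_closed C X -> (forall f, f \in X -> f @: C = C) ->
    #|C| = \sum_(1 <= i < N.+1) i * k i ->
  #|[set f in X | cycle_type_on N C k f]| * \prod_(1 <= i < N.+1) (i ^ k i * (k i)`!) = #|X|.
Proof.
have [m] := ubnP #|C|; elim: m => // m IHm in C k X *.
rewrite ltnS => le_Cm clX XC card_C.
case: (posnP #|C|) => [/[dup]/cards0_eq C0 /eqP | C_gt0].
  rewrite card_C sum_nat_seq_eq0 => /allP k0.
  have {}k0 i : i \in index_iota 1 N.+1 -> k i = 0.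
    move=> i_in; have := implyP (k0 i i_in) isT; rewrite muln_eq0.
    by move: i_in; rewrite mem_index_iota; case: (i) => // j _ /eqP.
  rewrite big1_seq ?muln1 => [|i /k0->]; last by rewrite expn0 fact0.
  apply: eq_card => f; rewrite !inE; apply/andb_idr => _; apply/allP => i i_in.
  rewrite k0 ?muln0 //.
  by rewrite cards_eq0 -subset0 C0; apply/subsetP=> x; rewrite !inE.
have [i i_in ki_gt0] : exists2 i, i \in index_iota 1 N.+1 & 0 < k i.
  apply/hasP; apply: contraTT C_gt0 => /hasPn k0; rewrite -eqn0Ngt card_C.
  rewrite sum_nat_seq_eq0; apply/allP => i /k0; rewrite -eqn0Ngt => /eqP -> /=.
  by rewrite muln0.
have i_gt0 : 0 < i by move: i_in; rewrite mem_index_iota => /andP[].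
pose k' j := if j == i then (k i).-1 else k j.
have ki : k i = (k' i).+1 by rewrite /k' eqxx prednK.
have kj j : j != i -> k j = k' j by rewrite /k' => /negbTE->.
have sum_k' : \sum_(1 <= j < N.+1) j * k j = i + \sum_(1 <= j < N.+1) j * k' j.
  rewrite !(big_rem i i_in) /= ki mulnS -addnA; congr (_ + (_ + _)).
  by apply: eq_big_seq => j; rewrite mem_rem_uniq ?iota_uniq // inE => /andP[/kj->].
have prod_k' : \prod_(1 <= j < N.+1) (j ^ k j * (k j)`!) =
    i * k i * \prod_(1 <= j < N.+1) (j ^ k' j * (k' j)`!).
  rewrite !(big_rem i i_in) /= ki expnS factS.
  under eq_big_seq => j.
    rewrite mem_rem_uniq ?iota_uniq // inE => /andP[/kj-> _]; over.
  by rewrite mulnACA -mulnA.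
have le_iC : i <= #|C| by rewrite card_C sum_k' leq_addr.
have [a ua aC] := exists_uniq_tuple le_iC.
pose Xc (c : seq T) := [set f in X | map f c == rot 1 c].
(* Once the cycle [c] is prescribed, the family is closed under permutations of the rest of [C], so
   induction applies there with type [k']. *)
have card_Xc (c : i.-tuple T) : uniq c && all (mem C) c ->
    #|[set f in Xc c | cycle_type_on N C k f]| *
      \prod_(1 <= j < N.+1) (j ^ k' j * (k' j)`!) = #|Xc c|.
  case/andP=> uc cC; have sub_c : [set x in c] \subset C.
    by apply/subsetP => x; rewrite inE => /(allP cC).
  rewrite -(IHm (C :\: [set x in c]) k' (Xc c)).
  - congr (_ * _); apply: eq_card => f; rewrite !inE -!andbA; apply: andb_id2l => fX.
    apply: andb_id2l => fc; rewrite -fcycle_map_rot in fc.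
    by apply: cycle_type_on_setD; rewrite ?size_tuple.
  - rewrite (leq_trans _ le_Cm) // cardsD (setIidPr sub_c) cardsE (card_uniqP uc) size_tuple.
    by rewrite ltn_subrL i_gt0.
  - move=> s f sD /[!inE]/andP[fX /eqP fc].
    rewrite (clX _ _ (subset_trans sD (subsetDl _ _)) fX) -fc; apply/eqP/eq_in_map => x xc.
    by rewrite ffunE (out_perm sD) // !inE xc.
  - move=> f /[!inE]/andP[fX fc]; apply: imset_self_setD => //; first exact: XC.
    by apply: imset_fcycle; rewrite fcycle_map_rot.
  rewrite cardsD (setIidPr sub_c) cardsE (card_uniqP uc) size_tuple card_C sum_k'.
  by rewrite addKn.
have mark_cycle : #|[set f in X | cycle_type_on N C k f]| * (i * k i) =
    \sum_(c : i.-tuple T | uniq c && all (mem C) c) #|[set f in Xc c | cycle_type_on N C k f]|.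
  rewrite -sum_nat_const.
  transitivity (\sum_(f in [set f in X | cycle_type_on N C k f])
    \sum_(c : i.-tuple T | uniq c && all (mem C) c) (map f c == rot 1 c)).
    apply: eq_bigr => f; rewrite inE => /andP[fX /allP type_f].
    rewrite -(eqP (type_f i i_in)) -(card_fcycles (XC f fX) i_gt0) -sum1dep_card.
    by rewrite big_mkcondr; apply: eq_bigr => c _; case: (_ == _).
  rewrite exchange_big /=; apply: eq_bigr => c _.
  rewrite -sum1dep_card big_mkcond [RHS]big_mkcond; apply: eq_bigr => f _.
  by rewrite !inE; case: (f \in X); case: cycle_type_on; case: (_ == _).
(* Summing over all marked cycles [c] gives the [f] in [X] that map [a] injectively into [C], which
   is all of [X]. *)
rewrite prod_k' mulnA mark_cycle big_distrl /= (eq_bigr _ card_Xc).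
rewrite (sum_card_map_rot 1 clX ua aC); apply: eq_card => f; rewrite !inE.
by apply/andb_idr => fX; apply: imset_self_uniq_map; rewrite ?XC.
Qed.

(** Sending a point to the vertex set of its orbit reaches every cycle of length [l], with its [l]
    vertices as fibre. *)
Lemma card_cycles_of_length n (pi : {ffun 'I_n -> 'I_n}) l : 0 < l ->
  l * #|cycles_of_length pi l| = #|[set x in cyclic_points pi | order pi x == l]|.
Proof.
move=> l_gt0; set C := cyclic_points pi; set A := [set x in C | _].
have piC : pi @: C = C by apply: imset_cyclic_points.
have homC : {homo pi : y / y \in C} by move=> y yC; rewrite -piC imset_f.
have fcycle_orbit x : x \in C -> fcycle pi (orbit pi x).
  exact: (cycle_orbit_in homC (imset_self_inj piC)).
pose supp x := [set y in orbit pi x].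
have -> : cycles_of_length pi l = supp @: A.
  apply/setP=> S.
  apply/imsetP/imsetP => [[c /[!inE]/andP[fc uc] ->]|[x /[!inE]/andP[xC ord_x] ->]].
    have [x xc] : exists x, x \in val c.
      case: c {fc uc} => -[|x s] /= => [/eqP l0|_]; first by rewrite -l0 in l_gt0.
      by exists x; rewrite mem_head.
    exists x; last by apply/setP=> y; rewrite !inE -fconnect_orbit (fconnect_cycle fc xc).
    rewrite inE (order_cycle fc uc xc) size_tuple eqxx andbT.
    by apply: (subsetP (sub_cyclic_points (imset_fcycle fc))); rewrite inE.
  have sz_x : size (orbit pi x) == l by rewrite size_orbit.
  by exists (Tuple sz_x); rewrite ?inE ?fcycle_orbit ?orbit_uniq.
rewrite -[RHS]sum1_card (partition_big_imset supp) /= mulnC -sum_nat_const.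
apply: eq_bigr => S /imsetP[x /[!inE]/andP[xC /eqP ord_x] ->].
rewrite -ord_x -size_orbit -(card_uniqP (orbit_uniq pi x)) sum1dep_card.
apply: eq_card => y; rewrite !inE; apply/idP/andP => [xy | [_ /eqP/setP/(_ y)]]; last first.
  by rewrite !inE in_orbit.
have fx := fcycle_orbit x xC.
split; last by apply/eqP/setP=> z; rewrite !inE -fconnect_orbit (fconnect_cycle fx xy).
rewrite (eq_order_cycle fx (in_orbit pi x) xy) ord_x eqxx andbT.
have := sub_cyclic_points (imset_fcycle fx); move/subsetP; apply; by rewrite inE.
Qed.

Lemma has_cycle_countsE n (pi : {ffun 'I_n -> 'I_n}) k :
  has_cycle_counts k pi = cycle_type_on n (cyclic_points pi) k pi.
Proof.
rewrite /cycle_type_on /index_iota subn1.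
apply: eq_in_all => i; rewrite mem_iota => /andP[i_gt0 _].
by rewrite -card_cycles_of_length // eqn_pmul2l.
Qed.

Lemma card_cycle_type_cyclic_points n (C : {set 'I_n}) (pi : {ffun 'I_n -> 'I_n}) k :
  cycle_type_on n C k pi -> #|C| = \sum_(1 <= i < n.+1) i * k i.
Proof.
move=> /allP type_pi.
transitivity (\sum_(1 <= i < n.+1) #|[set x in C | order pi x == i]|); last first.
  by apply: eq_big_seq => i i_in; apply/eqP/type_pi.
under eq_bigr => i _ do rewrite -sum1dep_card big_mkcondr.
rewrite exchange_big -sum1_card /=; apply: eq_bigr => x _.
have ord_in : order pi x \in index_iota 1 n.+1.
  by rewrite mem_index_iota ltnS order_gt0 -[X in _ <= X]card_ord max_card.
rewrite (big_rem _ ord_in) /= eqxx big1_seq // => i.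
by rewrite mem_rem_uniq ?iota_uniq // inE eq_sym => /andP[_ /andP[/negbTE-> _]].
Qed.

(** * Counting parking functions by the number of cyclic points *)

Definition parking_functions n : {set {ffun 'I_n -> 'I_n}} := [set pi | parking_function pi].

Lemma precomp_closed_parking_functions n : precomp_closed setT (parking_functions n).
Proof. by move=> s f _; rewrite !inE parking_function_precomp. Qed.

(** Both sides are split by the cyclic set [C]. A set of the wrong size contributes nothing to
    either side; for the others the cycle type count applies. *)
Lemma card_parking_functions_with_cycle_counts n (k : nat -> nat) :
  #|parking_functions_with_cycle_counts n k| * \prod_(1 <= i < n.+1) (i ^ k i * (k i)`!) =
  #|[set pi in parking_functions n | #|cyclic_points pi| == \sum_(1 <= i < n.+1) i * k i]|.
Proof.
have -> : parking_functions_with_cycle_counts n k =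
    [set pi in parking_functions n | has_cycle_counts k pi].
  by apply/setP=> pi; rewrite !inE.
rewrite !card_cyclic_points_eq big_distrl; apply: eq_bigr => C _ /=.
set X := [set pi in parking_functions n | cyclic_points pi == C].
have def_C pi : pi \in X -> cyclic_points pi = C by rewrite inE => /andP[_ /eqP].
have -> : [set pi in X | has_cycle_counts k pi] = [set pi in X | cycle_type_on n C k pi].
  apply/setP=> pi; rewrite [LHS]in_set [RHS]in_set; apply: andb_id2l => piX.
  by rewrite has_cycle_countsE def_C.
have -> : [set pi in X | #|cyclic_points pi| == \sum_(1 <= i < n.+1) i * k i] =
    [set pi in X | #|C| == \sum_(1 <= i < n.+1) i * k i].
  apply/setP=> pi; rewrite [LHS]in_set [RHS]in_set; apply: andb_id2l => piX.
  by rewrite def_C.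
case: eqP => [card_C | neq_C].
  rewrite card_cycle_type_on //; last by move=> pi /def_C <-; apply: imset_cyclic_points.
    by apply: eq_card => pi; rewrite !inE andbT.
  exact: (precomp_closed_cyclic_points (@precomp_closed_parking_functions n)).
rewrite (_ : [set pi in X | false] = set0); last by apply/setP=> pi; rewrite !inE andbF.
rewrite (_ : [set pi in X | _] = set0) ?cards0 //; apply/setP=> pi; rewrite in_set0 in_set.
apply/negP => /andP[_ /card_cycle_type_cyclic_points]; exact: neq_C.
Qed.

Lemma card_parking_cyclic_points_ge n m : m <= n ->
  #|[set pi in parking_functions n | m <= #|cyclic_points pi|]| * n.+1 =
  n.+1 ^_ m * n.+1 ^ (n - m).
Proof.
rewrite -{1}(card_ord n) -cardsT => /exists_uniq_tuple[a ua _].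
rewrite -{2 3}(size_tuple a) -card_parking_uniq_map // -{1}(size_tuple a).
rewrite -card_uniq_map_cyclic_points //; last exact: precomp_closed_parking_functions.
by congr (_ * _); apply: eq_card => pi; rewrite !inE.
Qed.

Lemma card_parking_cyclic_points_eq n m :
  #|[set pi in parking_functions n | #|cyclic_points pi| == m]| +
  #|[set pi in parking_functions n | m < #|cyclic_points pi|]| =
  #|[set pi in parking_functions n | m <= #|cyclic_points pi|]|.
Proof.
rewrite -(cardsID [set pi | #|cyclic_points pi| == m] [set pi in _ | m <= _]).
congr (_ + _); apply: eq_card => pi; rewrite !inE; case: (parking_function pi) => //=.
  by apply/eqP/andP => [->|[_ /eqP]].
  by rewrite ltn_neqAle eq_sym.
by rewrite andbF.
Qed.

Lemma card_parking_all_cyclic n :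
  #|[set pi in parking_functions n | #|cyclic_points pi| == n]| = n`!.
Proof.
apply/eqP; rewrite -(eqn_pmul2r (ltn0Sn n)) mulnC [_`! * _]mulnC -factS.
have := card_parking_cyclic_points_ge (leqnn n); rewrite subnn muln1 => card_ge.
(* At [m = n] the falling factorial is already (n+1)!, and cancelling [n.+1] leaves n!. *)
have := ffact_fact (leqnSn n); rewrite subSnn muln1 -card_ge mulnC => <-.
apply/eqP; congr (_ * _); apply: eq_card => pi; rewrite !inE.
by rewrite eqn_leq -[X in _ <= X](card_ord n) max_card.
Qed.

(** Difference of the counts for at least [m] and at least [m.+1] cyclic points: after the common
    factors, (n+1) - (n+1-m) = m remains. *)
Lemma card_parking_cyclic n m : m < n ->
  #|[set pi in parking_functions n | #|cyclic_points pi| == m]| * n.+1 =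
  n.+1 ^_ m * n.+1 ^ (n - m.+1) * m.
Proof.
move=> lt_mn; have := card_parking_cyclic_points_ge lt_mn.
have := card_parking_cyclic_points_ge (ltnW lt_mn).
rewrite -card_parking_cyclic_points_eq mulnDl => + card_gt; rewrite card_gt.
rewrite ffactnSr -(subnSK lt_mn) expnS.
move: (_ ^_ _) (_ ^ _) #|_| => F E T eq_T.
have : n.+1 = (n.+1 - m) + m by lia.
move: eq_T; move: (n.+1 - m) => d + eq_n; rewrite {2}eq_n; nia.
Qed.

Import Order.TTheory GRing.Theory Num.Theory.
Local Open Scope ring_scope.

Theorem theorem19 (n : nat) (n_ge1 : (1 <= n)%N) (k : nat -> nat) (K : nat)
    (K_def : K = (\sum_(1 <= i < n.+1) i * k i)%N) :
  (K = n ->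
    #|parking_functions_with_cycle_counts n k|%:R =
      1 / (\prod_(1 <= i < n.+1) (i ^ k i * (k i)`!))%N%:R * n`!%:R :> rat)
  /\
  ((1 <= K < n)%N ->
    #|parking_functions_with_cycle_counts n k|%:R =
      1 / (\prod_(1 <= i < n.+1) (i ^ k i * (k i)`!))%N%:R
        * 'C(n.+1, K)%:R * K`!%:R * K%:R
        * n.+1%:R ^ (n%:Z - K%:Z - 2) :> rat).
Proof.
have := card_parking_functions_with_cycle_counts n k; rewrite -K_def.
set z := (\prod_(_ <= _ < _) _)%N => card_z.
have z_neq0 : z%:R != 0 :> rat.
  rewrite pnatr_eq0 -lt0n /z big_nat_cond; apply: prodn_cond_gt0 => i /andP[/andP[i_gt0 _] _].
  by rewrite muln_gt0 expn_gt0 i_gt0 fact_gt0.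
have -> : #|parking_functions_with_cycle_counts n k|%:R =
    1 / z%:R * #|[set pi in parking_functions n | #|cyclic_points pi| == K]|%:R :> rat.
  by rewrite -card_z natrM mulrC mul1r mulfK.
split=> [->|/andP[_ lt_Kn]]; first by rewrite card_parking_all_cyclic.
have n1_neq0 : n.+1%:R != 0 :> rat by rewrite pnatr_eq0.
rewrite -!mulrA; congr (_ * (_ * _)).
apply: (mulIf n1_neq0); rewrite -natrM card_parking_cyclic // -bin_ffact !natrM natrX.
(* The exponent is -1 when [K = n - 1], so it is written as a natural number minus 1; the negative
   power cancels against the factor [n.+1] just introduced. *)
have -> : n%:Z - K%:Z - 2 = (n - K.+1)%N%:Z - 1 by lia.
rewrite expfzDr // exprN1 -exprnP; field.
by rewrite addrC natr1.
Qed.
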